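(* There is an absolute constant $c>0$ such that for any deletion rate $\delta=\delta(n)$ with $\delta(n)\cdot n\to\infty$ as $n\to\infty$, and all sufficiently large $n$, we have $L_{1,\mathrm{avg}}(\delta,n)\le(1-c\delta)n$.
   Context: For $x\in\{0,1\}^n$ and $0<\delta<1$, the deletion channel $\mathrm{Del}_\delta(x)$ is the distribution over $\{0,1\}^{\le n}$ obtained by independently deleting each bit of $x$ with probability $\delta$ and concatenating the surviving bits; a draw is a trace of $x$. $|\mathsf{LCS}(u,v)|$ denotes the length of a longest common subsequence of $u,v$. Define $L_{1,\mathrm{avg}}(\delta,n):=\max_A\mathbb{E}_{x\sim\{0,1\}^n}\mathbb{E}_{y\sim\mathrm{Del}_\delta(x)}[|\mathsf{LCS}(A(y,n),x)|]$, with $x$ uniform and the maximum over all algorithms $A$ that receive $n,\delta$ and a single trace $y$ and output an $n$-bit string. *)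

(* Defs.v *)
From HB Require Import structures.
From mathcomp Require Import all_boot all_order all_algebra.
From mathcomp Require Import all_classical all_reals all_analysis.
Import Order.TTheory GRing.Theory Num.Theory.
Import numFieldNormedType.Exports.

Set Implicit Arguments.
Unset Strict Implicit.
Unset Printing Implicit Defensive.

Local Open Scope ring_scope.

(* Every common subsequence of u and v has length at most size u. *)
Definition lcs (u v : seq bool) : nat :=
  (\max_(w : (size u).-bseq bool | subseq w u && subseq w v) size w)%N.

Section DeletionChannel.
Variables (R : realType) (delta : R) (n : nat).

(* In a deletion pattern, the i-th bit is true when position i survives. *)
Definition pattern_prob (m : n.-tuple bool) : R :=
  \prod_(i < n) (if tnth m i then 1 - delta else delta).

Definition Del (x : n.-tuple bool) (y : n.-bseq bool) : R :=
  \sum_(m : n.-tuple bool | mask m x == y :> seq bool) pattern_prob m.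

(* E_x E_{y ~ Del_delta(x)} [F x y], with x uniform over {0,1}^n. *)
Definition trace_expectation (F : n.-tuple bool -> n.-bseq bool -> R) : R :=
  (2 ^+ n)^-1 * \sum_(x : n.-tuple bool) \sum_(y : n.-bseq bool) Del x y * F x y.

(* Both n and delta are fixed here, so an algorithm is an arbitrary function
   of the trace. *)
Definition algorithm := {ffun n.-bseq bool -> n.-tuple bool}.

Definition value (A : algorithm) : R :=
  trace_expectation (fun x y => (lcs (A y) x)%:R).

(* The default 0 is harmless for 0 < delta < 1: see L1avg_attained. *)
Definition L1avg : R := \big[Num.max/0]_(A : algorithm) value A.

Hypothesis delta01 : 0 < delta < 1.

Lemma Del_ge0 x y : 0 <= Del x y.
Proof.
have /andP[d0 d1] := delta01.
apply: sumr_ge0 => m _; apply: prodr_ge0 => i _.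
by case: ifP => _; rewrite ?subr_ge0 ltW.
Qed.

Lemma Del_sum1 x : \sum_(y : n.-bseq bool) Del x y = 1.
Proof.
have sz (m : n.-tuple bool) : (size (mask m x) <= n)%N.
  by rewrite (leq_trans (size_subseq (mask_subseq m x))) ?size_tuple.
transitivity (\sum_(m : n.-tuple bool) pattern_prob m).
  by rewrite (partition_big (fun m => Bseq (sz m)) predT).
rewrite /pattern_prob.
pose G (i : 'I_n) (b : bool) : R := if b then 1 - delta else delta.
transitivity (\prod_(i < n) \sum_(b : bool) G i b); last first.
  by apply: big1 => i _; rewrite big_bool /G /= subrK.
rewrite bigA_distr_bigA /=.
rewrite (reindex (fun m : n.-tuple bool => [ffun i => tnth m i])) /=; last first.
  exists (fun f : {ffun 'I_n -> bool} => [tuple f i | i < n]) => [m|f] _.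
    by apply: eq_from_tnth => i; rewrite tnth_mktuple ffunE.
  by apply/ffunP => i; rewrite ffunE tnth_mktuple.
by apply: eq_bigr => m _; apply: eq_bigr => i _; rewrite ffunE.
Qed.

Lemma value_ge0 A : 0 <= value A.
Proof.
rewrite mulr_ge0 ?invr_ge0 ?exprn_ge0 //.
by apply: sumr_ge0 => x _; apply: sumr_ge0 => y _; rewrite mulr_ge0 ?Del_ge0.
Qed.

Lemma le_value_L1avg A : value A <= L1avg.
Proof. exact: le_bigmax. Qed.

Lemma L1avg_attained : exists A, L1avg = value A.
Proof.
pose A0 : algorithm := [ffun=> [tuple of nseq n false]].
have [A _ eA] := eq_bigmax A0 predT value isT (fun A _ => value_ge0 A).
by exists A; rewrite /L1avg eA.
Qed.

(* Randomized algorithms, drawing their output from Q y, do no better. *)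
Lemma randomized_le_L1avg (Q : n.-bseq bool -> n.-tuple bool -> R) :
    (forall y z, 0 <= Q y z) -> (forall y, \sum_z Q y z = 1) ->
  trace_expectation (fun x y => \sum_z Q y z * (lcs z x)%:R) <= L1avg.
Proof.
move=> Q0 Q1.
pose g y z : R := \sum_x Del x y * (lcs z x)%:R.
pose z0 : n.-tuple bool := [tuple of nseq n false].
pose A : algorithm := [ffun y => [arg max_(z > z0) g y z]%O].
apply: le_trans (le_value_L1avg A).
rewrite ler_pM2l ?invr_gt0 ?exprn_gt0 // exchange_big [leRHS]exchange_big /=.
apply: ler_sum => y _.
have -> : \sum_x Del x y * (\sum_z Q y z * (lcs z x)%:R) =
          \sum_z Q y z * g y z.
  rewrite /g; under eq_bigr do rewrite mulr_sumr.
  rewrite exchange_big /=; apply: eq_bigr => z _.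
  by rewrite mulr_sumr; apply: eq_bigr => x _; rewrite mulrCA.
rewrite -/(g y (A y)) -[leRHS]mul1r -(Q1 y) mulr_suml.
apply: ler_sum => z _; apply: ler_wpM2l => //.
by rewrite /A ffunE; case: arg_maxP => // z' _ gmax; exact: gmax.
Qed.

End DeletionChannel.

(* Main.v *)
(* Let x' be x with every deleted bit flipped. Then x and x' have the same
   trace for that deletion pattern, and x' is uniform when x is. By the triangle
   inequality for edit distance, no guess is close to both x and x', so it
   suffices to bound LCS(x, x') away from n.

   Fix the deletion pattern and an alignment of x and x' with k unmatched
   positions on each side. A pair matching a position to itself forces that bit
   to survive; the other r pairs are independent linear constraints on x, so
   only 2^(n-r) strings x fit the alignment. Cut [0, n) into blocks of length
   B ~ 1/delta; with probability at least 1/3 a quarter of them contain a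
   deletion. A block without unmatched positions is matched to itself
   everywhere or nowhere, hence nowhere if it contains a deletion. For k a small
   multiple of n/B this makes r of order n, however small delta is, and
   2^(n-r) beats the union bound over the C(n,k)^2 alignments. *)
Require Import Defs.
From mathcomp Require Import all_boot all_order all_algebra.
From mathcomp Require Import all_classical all_reals all_analysis.
From mathcomp Require Import zify ring lra.
Import Order.TTheory GRing.Theory Num.Theory.
Import numFieldNormedType.Exports.

Set Implicit Arguments.
Unset Strict Implicit.
Unset Printing Implicit Defensive.

(** * Common subsequences and the triangle inequality *)

Lemma lcs_witness (u v : seq bool) :
  exists w, [/\ subseq w u, subseq w v & size w = lcs u v].
Proof.
have P0 : (0 < #|[pred w : (size u).-bseq bool | subseq w u && subseq w v]|)%N.
  by apply/card_gt0P; exists [bseq]; rewrite inE !sub0seq.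
have [w] := eq_bigmax_cond (fun w : (size u).-bseq bool => size w) P0.
by rewrite inE => /andP[wu wv] e; exists w; split.
Qed.

Lemma leq_lcs (u v w : seq bool) :
  subseq w u -> subseq w v -> (size w <= lcs u v)%N.
Proof.
move=> wu wv; pose w' := Bseq (size_subseq wu).
by apply: (@bigop.leq_bigmax_cond _ _ (fun w : (size u).-bseq bool => size w) w');
  rewrite wu wv.
Qed.

(** Inclusion-exclusion on positions of [s]: two sets of positions share at least
    [size w1 + size w2 - size s] of them. The induction keeps the head of [s] in [w] only when both
    subsequences use it. *)
Lemma subseq_overlap (T : eqType) (s w1 w2 : seq T) :
  subseq w1 s -> subseq w2 s ->
  exists w, [/\ subseq w w1, subseq w w2 &
                (size w1 + size w2 <= size s + size w)%N].
Proof.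
elim: s w1 w2 => [|a s IHs] w1 w2.
  by rewrite !subseq0 => /eqP-> /eqP->; exists [::].
case: w1 => [|a1 w1]; first by move=> _ w2s; exists [::]; rewrite !sub0seq addn0 (size_subseq w2s).
case: w2 => [|a2 w2]; first by move=> w1s _; exists [::]; rewrite !sub0seq !addn0 (size_subseq w1s).
have sc b (w : seq T) : subseq w (b :: w) by exact: subseq_cons.
have inv b v : subseq (b :: v) (a :: s) ->
    b = a /\ subseq v s \/ subseq (b :: v) s.
  by rewrite /=; case: eqP => [->|_]; [left|right].
move=> /inv[[-> s1]|s1] /inv[[-> s2]|s2].
- have [w [h1 h2 h3]] := IHs _ _ s1 s2; exists (a :: w).
  by rewrite /= eqxx; split=> //; lia.
- have [w [h1 h2 h3]] := IHs _ _ s1 s2; exists w.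
  split; [exact: subseq_trans h1 (sc _ _) | exact: h2 | move: h3 => /=; lia].
- have [w [h1 h2 h3]] := IHs _ _ s1 s2; exists w.
  split; [exact: h1 | exact: subseq_trans h2 (sc _ _) | move: h3 => /=; lia].
- have [w [h1 h2 h3]] := IHs _ _ s1 s2; exists w.
  by split=> //; move: h3 => /=; lia.
Qed.

(** A common subsequence of [z, x] and one of [z, x'] overlap inside [z], and the overlap is common
    to [x] and [x']. *)
Lemma lcs_triangle (z x x' : seq bool) :
  (lcs z x + lcs z x' <= size z + lcs x x')%N.
Proof.
have [w1 [w1z w1x <-]] := lcs_witness z x.
have [w2 [w2z w2x <-]] := lcs_witness z x'.
have [w [ww1 ww2 le]] := subseq_overlap w1z w2z.
apply: leq_trans le _; rewrite leq_add2l leq_lcs //.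
  exact: subseq_trans ww1 w1x.
exact: subseq_trans ww2 w2x.
Qed.

(** * Alignments as pairs of increasing position tuples *)

Definition increasing (L n : nat) : {set L.-tuple 'I_n} :=
  [set t : L.-tuple 'I_n | sorted ltn (map val t)].

Lemma subseq_increasing (T : eqType) (L n : nat) (x : n.-tuple T) (w : seq T) :
  subseq w x -> size w = L ->
  exists2 t, t \in increasing L n & w = map (tnth x) t.
Proof.
move=> /subseqP[p szp ->] szw.
have ex : (x : seq T) = map (tnth x) (enum 'I_n) by rewrite map_tnth_enum.
have sz : size (mask p (enum 'I_n)) == L.
  by rewrite size_mask ?size_enum_ord -?szw ?size_mask ?szp ?size_tuple.
exists (Tuple sz); last by rewrite {1}ex -map_mask.
rewrite inE /= map_mask val_enum_ord.
by apply: sorted_mask; [exact: ltn_trans|exact: iota_ltn_sorted].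
Qed.

Lemma increasing_mono (L n : nat) (t : L.-tuple 'I_n) (a b : 'I_L) :
  t \in increasing L n -> (tnth t a < tnth t b)%N = (a < b)%N.
Proof.
rewrite inE => st.
have n0 : 'I_n := tnth t a.
have E (c : 'I_L) : val (tnth t c) = nth 0 (map val t) c.
  by rewrite (nth_map n0) ?size_tuple // -tnth_nth.
rewrite !E.
have mono c d : (c < d)%N -> (d < L)%N -> (nth 0 (map val t) c < nth 0 (map val t) d)%N.
  move=> cd dL; apply: (sorted_ltn_nth ltn_trans 0%N st); rewrite ?inE ?size_map ?size_tuple //.
  exact: ltn_trans cd dL.
case: (ltngtP a b) => [ab|ba|->]; rewrite ?ltnn //; first by rewrite mono.
by apply/negbTE; rewrite -leqNgt ltnW // mono.
Qed.

Lemma increasing_inj (L n : nat) (t : L.-tuple 'I_n) :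
  t \in increasing L n -> injective (tnth t).
Proof.
move=> ti a b /(congr1 val) /= E; apply: val_inj => /=.
have := increasing_mono a b ti; have := increasing_mono b a ti.
by rewrite E ltnn; lia.
Qed.

Definition nonfixed (L n : nat) (i j : L.-tuple 'I_n) : {set 'I_L} :=
  [set t | tnth i t != tnth j t].

(* The larger endpoint of each pair [i_t <> j_t] is strictly increasing in
   [t], so these constraints successively determine distinct bits of [x]. *)
Lemma card_aligned (L n : nat) (i j : L.-tuple 'I_n) (e : 'I_n -> bool) :
  i \in increasing L n -> j \in increasing L n ->
  (#|[set x : n.-tuple bool |
      [forall t, tnth x (tnth i t) == tnth x (tnth j t) (+) e (tnth j t)]]|
   * 2 ^ #|nonfixed i j| <= 2 ^ n)%N.
Proof.
move=> ii ij; set S := [set x | _].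
pose h t := if (tnth i t < tnth j t)%N then tnth j t else tnth i t.
have hinj : injective h.
  move=> a b /(congr1 val); apply: contra_eq => ab.
  have {}ab : (a < b)%N || (b < a)%N.
    by move: ab; rewrite -(inj_eq val_inj) neq_ltn.
  have := increasing_mono a b ii; have := increasing_mono b a ii.
  have := increasing_mono a b ij; have := increasing_mono b a ij.
  by rewrite /h; move: ab; do 2 case: ifP; move=> /=; lia.
pose H := h @: nonfixed i j.
(* The bits outside [H], stored as a set of positions, determine [x]: by strong induction on the
   position, a bit at [h t] is computed from the bit at the smaller endpoint of pair [t]. *)
pose f (x : n.-tuple bool) := [set p in ~: H | tnth x p].
have finj : {in S &, injective f}.
  move=> x y; rewrite !inE => /forallP xS /forallP yS fxy.
  apply: eq_from_tnth => p.
  have [m] := ubnP (val p); elim: m p => // m IHm p; rewrite ltnS => pm.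
  have [/imsetP[t]|pH] := boolP (p \in H); last first.
    by move/setP/(_ p): fxy; rewrite !inE pH.
  rewrite inE -(inj_eq val_inj) => ne ep.
  have /eqP xt := xS t; have /eqP yt := yS t.
  move: pm; rewrite ep /h; case: ltnP => [lt|ge] pm.
    have := IHm (tnth i t) (leq_trans lt pm).
    by rewrite xt yt => /addIb.
  have lt : (tnth j t < tnth i t)%N by rewrite ltn_neqAle eq_sym ne.
  by rewrite xt yt (IHm _ (leq_trans lt pm)).
have cH : #|H| = #|nonfixed i j| by rewrite card_imset.
rewrite -(card_in_imset finj).
have : (#|f @: S| <= #|powerset (~: H)|)%N.
  apply/subset_leq_card/fintype.subsetP => _ /imsetP[x _ ->].
  by rewrite powersetE; apply/fintype.subsetP => p; rewrite !inE => /andP[].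
rewrite card_powerset => le.
apply: leq_trans (leq_mul le (leqnn _)) _.
by rewrite -expnD -cH addnC cardsC card_ord.
Qed.

(** * Blocks and the number of nonfixed pairs *)

Lemma blockpos_subproof (n N B : nat) (NB : (N * B <= n)%N) (b : 'I_N) (c : 'I_B) :
  (b * B + c < n)%N.
Proof.
apply: leq_trans NB; apply: (@leq_trans (b.+1 * B)); last by rewrite leq_mul2r ltn_ord orbT.
by rewrite mulSn addnC ltn_add2r.
Qed.

Definition blockpos (n N B : nat) (NB : (N * B <= n)%N) (b : 'I_N) (c : 'I_B) : 'I_n :=
  Ordinal (blockpos_subproof NB b c).

Lemma blockpos_inj (n N B : nat) (NB : (N * B <= n)%N) (b b' : 'I_N) (c c' : 'I_B) :
  blockpos NB b c = blockpos NB b' c' -> b = b' /\ c = c'.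
Proof.
move=> /(congr1 val) /= E.
have B0 : (0 < B)%N by apply: leq_ltn_trans (ltn_ord c).
split; apply: val_inj => /=.
  move/(congr1 (divn^~ B)): E.
  by rewrite !divnMDl // !divn_small ?ltn_ord // !addn0.
move/(congr1 (modn^~ B)): E.
by rewrite !modnMDl !modn_small ?ltn_ord.
Qed.

(** An index strictly between [a] and [b] would need a position strictly between two consecutive
    ones. *)
Lemma increasing_succ (L n : nat) (t : L.-tuple 'I_n) (a b : 'I_L) :
  t \in increasing L n -> tnth t b = (tnth t a).+1 :> nat -> b = a.+1 :> nat.
Proof.
move=> ti E; have ab : (a < b)%N by rewrite -(increasing_mono _ _ ti) E.
apply/eqP; rewrite eqn_leq ab andbT leqNgt; apply/negP => lt.
have cL : (a.+1 < L)%N := ltn_trans lt (ltn_ord b).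
have := increasing_mono a (Ordinal cL) ti.
have := increasing_mono (Ordinal cL) b ti.
by rewrite E /= lt ltnSn; lia.
Qed.

(* Across a block contained in both images, the offset between the two
   embeddings is constant. *)
Lemma block_all_or_none (L n N B : nat) (NB : (N * B <= n)%N) (i j : L.-tuple 'I_n)
    (b : 'I_N) :
  i \in increasing L n -> j \in increasing L n ->
  (forall c : 'I_B, blockpos NB b c \in i) ->
  (forall c : 'I_B, blockpos NB b c \in j) ->
  forall c c' : 'I_B,
  (exists2 t, tnth i t = blockpos NB b c & tnth j t = blockpos NB b c) ->
  (exists2 t, tnth i t = blockpos NB b c' & tnth j t = blockpos NB b c').
Proof.
move=> ii ij bi bj.
(* If [t] is fixed at [c], then the indices that [i] and [j] send to the adjacent position [c'] are
   both the same neighbour of [t]. Induction on the distance then crosses the block. *)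
have step (c c' : 'I_B) : (c' = c.+1 :> nat \/ c = c'.+1 :> nat) ->
    (exists2 t, tnth i t = blockpos NB b c & tnth j t = blockpos NB b c) ->
    (exists2 t, tnth i t = blockpos NB b c' & tnth j t = blockpos NB b c').
  move=> cc' [t it jt].
  have /tnthP[s is_] := bi c'; have /tnthP[s' js] := bj c'.
  suff ss : s = s' by exists s; rewrite -?is_ // ss -js.
  apply: val_inj => /=; case: cc' => E.
    rewrite (@increasing_succ _ _ i t s) // -?is_ ?it /= ?E ?addnS //.
    by rewrite (@increasing_succ _ _ j t s') // -?js ?jt /= ?E ?addnS.
  apply: succn_inj; rewrite -(@increasing_succ _ _ i s t) // -?is_ ?it /= ?E ?addnS //.
  by rewrite -(@increasing_succ _ _ j s' t) // -?js ?jt /= ?E ?addnS.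
move=> c c'; have [m] := ubnP (`|c - c'|%N : nat).
elim: m c => // m IHm c; rewrite ltnS => cm fc.
have [lt|lt|/val_inj<-//] := ltngtP c c'.
  have d : (c.+1 < B)%N by apply: leq_ltn_trans (ltn_ord c').
  apply: (IHm (Ordinal d)); first by move: cm lt => /=; lia.
  by apply: step fc; left.
have d : (c.-1 < B)%N by apply: leq_ltn_trans (leq_pred _) (ltn_ord c).
apply: (IHm (Ordinal d)); first by move: cm lt => /=; lia.
by apply: step fc; right => /=; lia.
Qed.

(** The predicate [e] marks deleted positions in one use and positions missing from an embedding in
    another. *)
Definition hit_blocks (n N B : nat) (NB : (N * B <= n)%N) (e : 'I_n -> bool) : {set 'I_N} :=
  [set b | [exists c : 'I_B, e (blockpos NB b c)]].

Lemma card_missed_blocks (L n N B : nat) (NB : (N * B <= n)%N) (i : L.-tuple 'I_n) :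
  i \in increasing L n ->
  (#|hit_blocks NB (fun p => p \notin i)| <= n - L)%N.
Proof.
move=> ii.
have cI : #|[set p | p \notin i]| = (n - L)%N.
  have -> : [set p | p \notin i] = ~: [set p in i] by apply/setP => p; rewrite !inE.
  rewrite cardsCs finset.setCK card_ord cardsE; congr (_ - _)%N.
  by rewrite (card_uniqP _) ?size_tuple // -(map_tnth_enum i) map_inj_uniq ?enum_uniq //;
    exact: increasing_inj.
rewrite -cI.
have [->|[b0 _]] := set_0Vmem (hit_blocks NB (fun p => p \notin i)); first by rewrite cards0.
(* The default [b0] serves positions from [N * B] on, which lie in no block. *)
pose f (p : 'I_n) : 'I_N := insubd b0 (p %/ B)%N.
apply: leq_trans (leq_imset_card f _).
apply/subset_leq_card/fintype.subsetP => b; rewrite inE => /existsP[c ci].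
apply/imsetP; exists (blockpos NB b c); rewrite ?inE //.
have B0 : (0 < B)%N by apply: leq_ltn_trans (ltn_ord c).
apply: val_inj; rewrite /f val_insubd /= divnMDl // divn_small ?ltn_ord // addn0.
by rewrite ltn_ord.
Qed.

(** In a block that meets [e] and is covered by both embeddings, a fixed position would force the
    whole block to be fixed, including a position of [e]. So all [B] positions of such a block come
    from nonfixed indices. *)
Lemma card_nonfixed (L n N B : nat) (NB : (N * B <= n)%N) (i j : L.-tuple 'I_n)
    (e : 'I_n -> bool) :
  i \in increasing L n -> j \in increasing L n ->
  (forall t, tnth i t = tnth j t -> ~~ e (tnth i t)) ->
  ((#|hit_blocks NB e| - 2 * (n - L)) * B <= #|nonfixed i j|)%N.
Proof.
move=> ii ij fix_e.
(* Each embedding misses [n - L] positions and so spoils at most [n - L] blocks. *)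
pose G := hit_blocks NB e :\: (hit_blocks NB (fun p => p \notin i) :|:
                               hit_blocks NB (fun p => p \notin j)).
have cG : (#|hit_blocks NB e| - 2 * (n - L) <= #|G|)%N.
  rewrite cardsD leq_sub2l // (leq_trans (subset_leq_card (finset.subsetIr _ _))) //.
  rewrite (leq_trans (leq_card_setU _ _)) // mul2n -addnn.
  by rewrite leq_add ?card_missed_blocks.
apply: leq_trans (leq_mul cG (leqnn B)) _.
rewrite -(card_imset _ (increasing_inj ii)) -[in X in (_ * X)%N](card_ord B) -cardsT.
rewrite -cardsX.
pose f (bc : 'I_N * 'I_B) := blockpos NB bc.1 bc.2.
have finj : injective f.
  by case=> b c [b' c'] /= /blockpos_inj[/= -> ->].
rewrite -(card_imset _ finj); apply/subset_leq_card/fintype.subsetP => _ /imsetP[[b c] + ->].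
rewrite !inE negb_or andbT /= => /andP[/andP[bi bj] /existsP[c0 ec0]].
have {}bi (c1 : 'I_B) : blockpos NB b c1 \in i.
  by move: bi; rewrite negb_exists => /forallP/(_ c1); rewrite negbK.
have {}bj (c1 : 'I_B) : blockpos NB b c1 \in j.
  by move: bj; rewrite negb_exists => /forallP/(_ c1); rewrite negbK.
have /tnthP[t it] := bi c; apply/imsetP; exists t => //; rewrite inE.
apply/eqP => ijt.
have [|t0 it0 jt0] := @block_all_or_none _ _ _ _ NB i j b ii ij bi bj c c0.
  by exists t; rewrite -?ijt.
by have := fix_e t0; rewrite it0 jt0 => /(_ erefl); rewrite ec0.
Qed.

(** * Union bound over alignments *)

Definition flip (n : nat) (e : 'I_n -> bool) (x : n.-tuple bool) : n.-tuple bool :=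
  [tuple tnth x p (+) e p | p < n].

Lemma card_bigcup_le (I T : finType) (D : {set I}) (S : I -> {set T}) :
  (#|\bigcup_(i in D) S i| <= \sum_(i in D) #|S i|)%N.
Proof.
elim/big_rec2: _ => [|i m U _ le]; first by rewrite cards0.
by apply: leq_trans (leq_card_setU _ _) _; rewrite leq_add2l.
Qed.

Lemma card_lcs_flip (n N B k : nat) (NB : (N * B <= n)%N) (e : 'I_n -> bool) :
  (k <= n)%N ->
  (#|[set x : n.-tuple bool | (n - k <= lcs x (flip e x))%N]| *
     2 ^ ((#|hit_blocks NB e| - 2 * k) * B) <= 'C(n, k) ^ 2 * 2 ^ n)%N.
Proof.
move=> kn; set L := (n - k)%N.
pose S (ij : L.-tuple 'I_n * L.-tuple 'I_n) := [set x : n.-tuple bool |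
  [forall t, tnth x (tnth ij.1 t) == tnth x (tnth ij.2 t) (+) e (tnth ij.2 t)]].
set D := finset.setX (increasing L n) (increasing L n).
have sub : [set x : n.-tuple bool | (L <= lcs x (flip e x))%N] \subset \bigcup_(ij in D) S ij.
  apply/fintype.subsetP => x; rewrite inE => Lx.
  have [w [wx wx' sw]] := lcs_witness x (flip e x).
  (* Truncating to length exactly [L] leaves alignments of a single length to count. *)
  have sz : size (take L w) = L by rewrite size_takel // sw.
  have [i ii ei] := subseq_increasing (subseq_trans (take_subseq _ _) wx) sz.
  have [j ij ej] := subseq_increasing (subseq_trans (take_subseq _ _) wx') sz.
  apply/bigcupP; exists (i, j); rewrite inE ?ii //=; apply/forallP => t.
  have := congr1 (nth true ^~ t) (etrans (esym ei) ej).
  by rewrite !(nth_map (tnth i t)) ?size_tuple // -!tnth_nth tnth_mktuple => ->.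
apply: (@leq_trans (\sum_(ij in D) 2 ^ n)).
  apply: leq_trans (leq_mul (subset_leq_card sub) (leqnn _)) _.
  apply: leq_trans (leq_mul (card_bigcup_le _ _) (leqnn _)) _.
  rewrite big_distrl /=; apply: leq_sum => -[i j]; rewrite inE /= => /andP[ii ij].
  (* A member [x] is needed below: a fixed pair at position [p] makes the bit of [x] at [p] equal to
     itself xor [e p], so [e p] is false. *)
  have [->|[x]] := set_0Vmem (S (i, j)); first by rewrite cards0 mul0n.
  rewrite inE => /forallP /= xS.
  apply: leq_trans (card_aligned e ii ij); rewrite leq_mul2l leq_pexp2l ?orbT //.
  have -> : k = (n - L)%N by rewrite subKn.
  apply: card_nonfixed => // t E; have := xS t; rewrite E.
  by case: (tnth x _); case: (e _).
by rewrite sum_nat_const cardsX !card_ltn_sorted_tuples bin_sub.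
Qed.

(** * Binomial coefficient estimates *)

(** Bernoulli's inequality [(1 - 1/(T+1))^d >= 1 - d/(T+1)], cleared of denominators. *)
Lemma leq_bernoulli (T d : nat) : (d <= T.+1)%N ->
  (T.+1 ^ d * (T.+1 - d) <= T ^ d * T.+1)%N.
Proof.
elim: d => [|d IHd] dT; first by rewrite !expn0 subn0.
have {}IHd := IHd (ltnW dT).
rewrite !expnS.
have h : (T.+1 * (T.+1 - d.+1) <= T * (T.+1 - d))%N by nia.
apply: (@leq_trans (T.+1 ^ d * (T * (T.+1 - d)))).
  by rewrite (mulnC T.+1) -mulnA leq_mul2l h orbT.
by rewrite mulnCA -mulnA leq_mul2l IHd orbT.
Qed.

(** The left side is [T ^ k] times a single term of the expansion of [(T + 1) ^ n]. *)
Lemma bin_exp_bound (n k T : nat) : (k <= n)%N ->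
  ('C(n, k) * T ^ n <= T.+1 ^ n * T ^ k)%N.
Proof.
move=> kn; rewrite -addn1 expnDn -{2}(subnK kn) expnD mulnA leq_mul2r.
apply/orP; right; have kn' : (k < n.+1)%N by [].
by rewrite (bigD1 (Ordinal kn')) //= exp1n muln1 leq_addr.
Qed.

(** Bernoulli with [T = 2m] and [d = m] bounds the ratio by [(2m+1)/(m+1)], which is below 2. *)
Lemma exp_succ_double_le (m : nat) : ((m.*2).+1 ^ m <= 2 * m.*2 ^ m)%N.
Proof.
have := @leq_bernoulli m.*2 m ltac:(lia).
move: (_ ^ m)%N (_ ^ m)%N => a b h.
rewrite -(@leq_pmul2r m.+1) //; apply: leq_trans (leq_trans h _); last by nia.
by rewrite leq_mul2l; apply/orP; right; lia.
Qed.

Lemma bin_sq_bound (n k r : nat) :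
  (32 <= n)%N -> (1024 * k <= n)%N -> (n <= 16 * r)%N ->
  (2 * 'C(n, k) ^ 2 <= 2 ^ r)%N.
Proof.
move=> n32 kn rn.
have kn' : (k <= n)%N by lia.
(* With [T = 256], ['C(n, k) <= (257/256)^n * 256^k]. The power [m = 128], half of [T], turns the
   first factor into at most [2 ^ n] and the second into [2 ^ (1024 * k)]. *)
have hC : ('C(n, k) ^ 128 <= 2 ^ (n + 1024 * k))%N.
  have [m em] : exists m, m = 128 by exists 128.
  have eT : m.*2 = (2 ^ 8)%N by rewrite em.
  have m0 : (0 < m)%N by rewrite em.
  have := bin_exp_bound m.*2 kn'; rewrite -em -(@leq_exp2r _ _ m) // !expnMn => h.
  rewrite -(@leq_pmul2r ((m.*2 ^ n) ^ m)); last by rewrite !expn_gt0 double_gt0 m0.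
  apply: leq_trans h _.
  rewrite -!expnM (mulnC n) expnM.
  apply: (@leq_trans ((2 * m.*2 ^ m) ^ n * m.*2 ^ (k * m))).
    rewrite leq_mul2r; apply/orP; right.
    by rewrite leq_exp2r ?exp_succ_double_le //; lia.
  rewrite expnMn -expnM expnD -!mulnA leq_mul2l; apply/orP; right.
  rewrite mulnC leq_mul2r; apply/orP; right.
  by rewrite eT -expnM leq_pexp2l //; rewrite em; lia.
have h2 : ('C(n, k) ^ 64 <= 2 ^ n)%N.
  rewrite -(@leq_exp2r _ _ 2) // -!expnM.
  apply: leq_trans hC _; rewrite leq_pexp2l //; lia.
(* The 32nd power of the goal follows from [32 + n <= 2 * n <= 32 * r]. *)
rewrite -(@leq_exp2r _ _ 32) // expnMn -!expnM.
apply: (@leq_trans (2 ^ 32 * 2 ^ n)); first by rewrite leq_mul2l; apply/orP; right; exact: h2.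
by rewrite -expnD leq_pexp2l //; lia.
Qed.

(** * Eliminating the algorithm for a fixed deletion pattern *)

Lemma leq_lcs_size (u v : seq bool) : (lcs u v <= size u)%N.
Proof. by have [w [wu _ <-]] := lcs_witness u v; exact: size_subseq. Qed.

Lemma size_trace (n : nat) (m x : n.-tuple bool) : (size (mask m x) <= n)%N.
Proof. by rewrite (leq_trans (size_subseq (mask_subseq m x))) ?size_tuple. Qed.

Definition trace (n : nat) (m x : n.-tuple bool) : n.-bseq bool := Bseq (size_trace m x).

Definition deleted (n : nat) (m : n.-tuple bool) (p : 'I_n) : bool := ~~ tnth m p.

Lemma flipK (n : nat) (e : 'I_n -> bool) : involutive (flip e).
Proof. by move=> x; apply: eq_from_tnth => p; rewrite !tnth_mktuple addbK. Qed.

Lemma eq_mask (T : eqType) (m : bitseq) (s t : seq T) (x0 : T) :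
  size s = size t -> (forall p, nth false m p -> nth x0 s p = nth x0 t p) ->
  mask m s = mask m t.
Proof.
elim: m s t => [|b m IHm] [|x s] [|y t] //= [sz] h.
have -> : mask m s = mask m t by apply: IHm => // p; exact: (h p.+1).
by case: b h => // /(_ 0%N isT) /= ->.
Qed.

Lemma trace_flip (n : nat) (m x : n.-tuple bool) :
  trace m (flip (deleted m) x) = trace m x.
Proof.
apply: val_inj; apply: (@eq_mask _ _ (flip (deleted m) x) x false); first by rewrite !size_tuple.
move=> p mp; have pn : (p < n)%N.
  by rewrite ltnNge; apply/negP => np; move: mp; rewrite nth_default ?size_tuple.
rewrite -!(tnth_nth _ _ (Ordinal pn)) tnth_mktuple /deleted.
by rewrite (tnth_nth false m) mp addbF.
Qed.

(* Averaging [lcs_triangle] over the involution [flip], which fixes traces,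
   removes the algorithm from the problem. *)
Lemma sum_lcs_trace_le (n : nat) (A : n.-bseq bool -> n.-tuple bool) (m : n.-tuple bool) :
  (2 * \sum_(x : n.-tuple bool) lcs (A (trace m x)) x <=
   n * 2 ^ n + \sum_(x : n.-tuple bool) lcs x (flip (deleted m) x))%N.
Proof.
rewrite mul2n -addnn {2}(reindex_inj (inv_inj (flipK (deleted m)))) /= -big_split /=.
have -> : (n * 2 ^ n = \sum_(x : n.-tuple bool) n)%N.
  by rewrite sum_nat_const card_tuple card_bool mulnC.
rewrite -big_split /=; apply: leq_sum => x _; rewrite trace_flip.
by apply: leq_trans (lcs_triangle _ _ _) _; rewrite size_tuple.
Qed.

Lemma sum_lcs_flip_le (n k : nat) (e : 'I_n -> bool) :
  (k < n)%N ->
  (2 * #|[set x : n.-tuple bool | (n - k <= lcs x (flip e x))%N]| <= 2 ^ n)%N ->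
  (2 * \sum_(x : n.-tuple bool) lcs x (flip e x) + k.+1 * 2 ^ n <= 2 * n * 2 ^ n)%N.
Proof.
move=> kn; set S := [set x | _] => S2.
(* Outside [S] the LCS is at most [n - k - 1], so each such string loses [k.+1]; these are at least
   half of all strings. *)
have h : (\sum_(x : n.-tuple bool) lcs x (flip e x) + k.+1 * #|~: S| <= n * 2 ^ n)%N.
  have -> : (k.+1 * #|~: S| = \sum_(x : n.-tuple bool) (x \notin S) * k.+1)%N.
    rewrite -big_distrl /= mulnC -sum1_card big_mkcond /=; congr (_ * _)%N.
    by apply: eq_bigr => x _; rewrite inE; case: (x \in S).
  have -> : (n * 2 ^ n = \sum_(x : n.-tuple bool) n)%N.
    by rewrite sum_nat_const card_tuple card_bool mulnC.
  rewrite -big_split /=; apply: leq_sum => x _.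
  have := leq_lcs_size x (flip e x); rewrite size_tuple inE -ltnNge.
  by case: ltnP => /=; lia.
have : (#|S| + #|~: S| = 2 ^ n)%N by rewrite cardsC card_tuple card_bool.
move: h S2; move: (\sum_(x : _) _)%N #|S| #|~: S| (2 ^ n)%N => a b c d; nia.
Qed.

Lemma sum_lcs_trace_good (n N B k : nat) (NB : (N * B <= n)%N)
    (A : n.-bseq bool -> n.-tuple bool) (m : n.-tuple bool) :
  (32 <= n)%N -> (n <= 2 * (N * B))%N -> (1024 * k <= N)%N ->
  (N <= 4 * #|hit_blocks NB (deleted m)|)%N ->
  (4 * (\sum_(x : n.-tuple bool) lcs (A (trace m x)) x) + k.+1 * 2 ^ n <= 4 * n * 2 ^ n)%N.
Proof.
move=> n32 nNB kN.
have /andP[N0 B0] : (0 < N)%N && (0 < B)%N by rewrite -muln_gt0; lia.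
move=> hit.
have Nn : (N <= n)%N by apply: (leq_trans _ NB); rewrite leq_pmulr.
set r := ((#|hit_blocks NB (deleted m)| - 2 * k) * B)%N.
(* At least [N/4] blocks are hit and [2 * k <= N/512], so [r >= N * B / 8], while
   [n <= 2 * (N * B)]. *)
have nr : (n <= 16 * r)%N.
  apply: leq_trans nNB _; rewrite /r !mulnA leq_mul2r; apply/orP; right; lia.
have C2 : (2 * 'C(n, k) ^ 2 <= 2 ^ r)%N by apply: bin_sq_bound => //; lia.
have kn : (k < n)%N by lia.
have S2 : (2 * #|[set x : n.-tuple bool |
                  (n - k <= lcs x (flip (deleted m) x))%N]| <= 2 ^ n)%N.
  have := card_lcs_flip NB (deleted m) (ltnW kn).
  have : (0 < 'C(n, k) ^ 2)%N by rewrite expn_gt0 bin_gt0 ltnW.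
  move: C2; rewrite -/r; move: #|_| ('C(n, k) ^ 2)%N (2 ^ r)%N (2 ^ n)%N => s c t u h1 h2 h3.
  rewrite -(@leq_pmul2l c) //; apply: leq_trans h3; rewrite mulnA mulnC leq_mul2l.
  by rewrite mulnC h1 orbT.
have := sum_lcs_flip_le kn S2; have := sum_lcs_trace_le A m.
move: (\sum_(x : _) _)%N (\sum_(x : _) _)%N => a b; move: (2 ^ n)%N => d; nia.
Qed.

Lemma sum_lcs_trace_trivial (n : nat)
    (A : n.-bseq bool -> n.-tuple bool) (m : n.-tuple bool) :
  (\sum_(x : n.-tuple bool) lcs (A (trace m x)) x <= n * 2 ^ n)%N.
Proof.
apply: (@leq_trans (\sum_(x : n.-tuple bool) n)).
  by apply: leq_sum => x _; rewrite (leq_trans (leq_lcs_size _ _)) ?size_tuple.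
by rewrite sum_nat_const card_tuple card_bool mulnC.
Qed.

Local Open Scope ring_scope.

(** * Random deletion patterns hit many blocks *)

Lemma pattern_prob_ge0 (R : realType) (delta : R) (n : nat) (m : n.-tuple bool) :
  0 < delta < 1 -> 0 <= pattern_prob delta m.
Proof.
move=> /andP[d0 d1]; apply: prodr_ge0 => i _.
by case: ifP => _; rewrite ?subr_ge0 ltW.
Qed.

Lemma pattern_prob_survive (R : realType) (delta : R) (n : nat) (S : {set 'I_n}) :
  \sum_(m : n.-tuple bool | [forall p in S, tnth m p]) pattern_prob delta m =
  (1 - delta) ^+ #|S|.
Proof.
(* Weight 0 for a deletion inside [S] removes the side condition, so the sum factors over
   positions. *)
pose G (p : 'I_n) (b : bool) : R :=
  if b then 1 - delta else if p \in S then 0 else delta.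
transitivity (\sum_(m : n.-tuple bool) \prod_(p < n) G p (tnth m p)).
  rewrite big_mkcond /=; apply: eq_bigr => m _; case: ifPn => [/forall_inP mS|].
    apply: eq_bigr => p _; rewrite /G; case: ifPn => // mp.
    by case: ifPn => // pS; rewrite mS in mp.
  rewrite negb_forall_in => /exists_inP[p pS mp].
  by rewrite (bigD1 p) //= /G (negbTE mp) pS mul0r.
transitivity (\prod_(p < n) \sum_(b : bool) G p b); last first.
  rewrite -prodr_const [RHS]big_mkcond /=; apply: eq_bigr => p _.
  by rewrite big_bool /G /=; case: ifP => _; rewrite ?addr0 ?subrK.
rewrite bigA_distr_bigA /=.
rewrite (reindex (fun m : n.-tuple bool => [ffun p => tnth m p])) /=; last first.
  exists (fun f : {ffun 'I_n -> bool} => [tuple f p | p < n]) => [m|f] _.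
    by apply: eq_from_tnth => p; rewrite tnth_mktuple ffunE.
  by apply/ffunP => p; rewrite ffunE tnth_mktuple.
by apply: eq_bigr => m _; apply: eq_bigr => p _; rewrite ffunE.
Qed.

Lemma pattern_prob_sum1 (R : realType) (delta : R) (n : nat) :
  \sum_(m : n.-tuple bool) pattern_prob delta m = 1.
Proof.
rewrite -[RHS](expr0 (1 - delta)) -(cards0 'I_n) -pattern_prob_survive.
by apply: eq_bigl => m; apply/esym/forall_inP => p; rewrite inE.
Qed.

(** Linearity of expectation: a block is missed when its [B] positions all survive. *)
Lemma expected_missed_blocks (R : realType) (delta : R) (n N B : nat)
    (NB : (N * B <= n)%N) :
  \sum_(m : n.-tuple bool)
     pattern_prob delta m * #|~: hit_blocks NB (deleted m)|%:R =
  N%:R * (1 - delta) ^+ B.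
Proof.
pose bl (b : 'I_N) : {set 'I_n} := [set blockpos NB b c | c : 'I_B].
have cbl b : #|bl b| = B.
  by rewrite card_imset ?card_ord // => c c' /blockpos_inj[].
have missE m b : (b \in ~: hit_blocks NB (deleted m)) = [forall p in bl b, tnth m p].
  rewrite !inE negb_exists; apply/forallP/forall_inP => [h _ /imsetP[c _ ->]|h c].
    by have := h c; rewrite negbK.
  by rewrite negbK h //; apply: imset_f.
transitivity (\sum_(b < N) (1 - delta) ^+ B); last first.
  by rewrite sumr_const card_ord mulr_natl.
under eq_bigr => m _ do rewrite -sum1_card natr_sum mulr_sumr big_mkcond /=.
rewrite exchange_big /=; apply: eq_bigr => b _.
rewrite -[in RHS](cbl b) -pattern_prob_survive [RHS]big_mkcond /=.
by apply: eq_bigr => m _; rewrite missE mulr1.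
Qed.

(** Used with [B * d >= 1], where it gives [(1 - d)^B <= 1/2]. *)
Lemma bernoulli_expr_le (R : realType) (d : R) (B : nat) :
  0 <= d <= 1 -> (1 - d) ^+ B * (1 + B%:R * d) <= 1.
Proof.
move=> /andP[d0 d1]; elim: B => [|B IHB]; first by rewrite mul0r addr0 mulr1.
apply: le_trans IHB; rewrite exprSr -mulrA ler_wpM2l ?exprn_ge0 ?subr_ge0 //.
have : 0 <= B%:R :> R by []. 
rewrite -natr1; nra.
Qed.

(** Markov's inequality: the expected number of missed blocks is at most [N/2], and a bad pattern
    misses at least [3N/4], so bad patterns have probability at most 2/3. *)
Lemma prob_good (R : realType) (delta : R) (n N B : nat) (NB : (N * B <= n)%N) :
  0 < delta < 1 -> (0 < N)%N -> 1 <= B%:R * delta ->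
  1 / 3 <= \sum_(m : n.-tuple bool | (N <= 4 * #|hit_blocks NB (deleted m)|)%N)
            pattern_prob delta m.
Proof.
move=> d01 N0 Bd; have /andP[d0 d1] := d01.
have := pattern_prob_sum1 delta n.
rewrite (bigID (fun m => (N <= 4 * #|hit_blocks NB (deleted m)|)%N)) /=.
set g := \sum_(m | _) _; set b := \sum_(m | ~~ _) _ => gb.
have hB : (1 - delta) ^+ B <= 1 / 2.
  have d01' : 0 <= delta <= 1 by rewrite !ltW.
  have := bernoulli_expr_le B d01'.
  have : 0 <= (1 - delta) ^+ B by rewrite exprn_ge0 // subr_ge0 ltW.
  nra.
suff : b * (3 / 4 * N%:R) <= N%:R * (1 / 2).
  have : 0 < N%:R :> R by rewrite ltr0n.
  move: gb; nra.
apply: (@le_trans _ _ (N%:R * (1 - delta) ^+ B)); last by rewrite ler_wpM2l.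
rewrite -(@expected_missed_blocks _ _ _ _ _ NB) /b big_distrl /=.
rewrite [leRHS](bigID (fun m => (N <= 4 * #|hit_blocks NB (deleted m)|)%N)) /=.
rewrite -[leLHS]add0r lerD //.
  by apply: sumr_ge0 => m _; rewrite mulr_ge0 // pattern_prob_ge0.
apply: ler_sum => m; rewrite -ltnNge => hit.
rewrite ler_wpM2l ?pattern_prob_ge0 //.
have : (3 * N <= 4 * #|~: hit_blocks NB (deleted m)|)%N.
  have := cardsC (hit_blocks NB (deleted m)); rewrite card_ord; move: hit.
  by move: #|hit_blocks _ _| #|~: _| => a c; lia.
rewrite -(ler_nat R) !natrM; lra.
Qed.

(** * Averaging over patterns and choosing parameters *)

(** Grouping patterns by the trace they produce replaces the average over traces by one over
    patterns, so the bounds for a fixed pattern apply. *)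
Lemma value_trace (R : realType) (delta : R) (n : nat) (A : algorithm n) :
  value delta A = (2 ^+ n)^-1 * \sum_(m : n.-tuple bool)
    pattern_prob delta m * (\sum_(x : n.-tuple bool) lcs (A (trace m x)) x)%:R.
Proof.
rewrite /value /trace_expectation; congr (_ * _).
under [RHS]eq_bigr => m _ do rewrite natr_sum mulr_sumr.
rewrite [RHS]exchange_big /=; apply: eq_bigr => x _.
rewrite (partition_big (fun m => trace m x) predT) //=.
apply: eq_bigr => y _; rewrite /Del big_distrl /=.
apply: eq_bigr => m /eqP mxy.
by have -> : y = trace m x by apply: val_inj.
Qed.

Lemma value_le (R : realType) (delta : R) (n N B k : nat) (A : algorithm n) :
  0 < delta < 1 -> (32 <= n)%N -> (N * B <= n)%N -> (n <= 2 * (N * B))%N ->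
  1 <= B%:R * delta -> (1024 * k <= N)%N ->
  value delta A <= n%:R - k.+1%:R / 12.
Proof.
move=> d01 n32 NB nNB Bd kN.
have N0 : (0 < N)%N by rewrite lt0n; apply/eqP => N0; move: nNB n32; rewrite N0; lia.
rewrite value_trace mulrC ler_pdivrMr ?exprn_gt0 //.
pose good (m : n.-tuple bool) := (N <= 4 * #|hit_blocks NB (deleted m)|)%N.
(* A good pattern loses [k.+1 / 4] on average over [x], a bad one possibly nothing. Good patterns
   have probability at least 1/3, whence the 12. *)
apply: (@le_trans _ _ (\sum_(m : n.-tuple bool) pattern_prob delta m *
   ((n%:R - (good m)%:R * (k.+1%:R / 4)) * 2 ^+ n))).
  apply: ler_sum => m _; rewrite ler_wpM2l ?pattern_prob_ge0 //.
  have [gm|_] := boolP (good m).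
    have := sum_lcs_trace_good A n32 nNB kN gm.
    rewrite -(ler_nat R) natrD !natrM natrX /= mul1r; move: (2 ^+ n : R) => t; lra.
  have := sum_lcs_trace_trivial A m.
  rewrite -(ler_nat R) !natrM natrX /= mul0r; lra.
under eq_bigr do rewrite (mulrA (pattern_prob _ _)); rewrite -mulr_suml ler_wpM2r ?exprn_ge0 //.
under eq_bigr do rewrite mulrBr; rewrite sumrB -mulr_suml pattern_prob_sum1 mul1r.
rewrite lerD2l lerN2.
under eq_bigr do rewrite (mulrA (pattern_prob _ _)); rewrite -mulr_suml.
have -> : \sum_(m : n.-tuple bool) pattern_prob delta m * (good m)%:R =
          \sum_(m | good m) pattern_prob delta m.
  by rewrite [RHS]big_mkcond; apply: eq_bigr => m _; case: ifP; rewrite ?mulr1 ?mulr0.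
have good13 : 1 / 3 <= \sum_(m | good m) pattern_prob delta m by exact: prob_good.
rewrite (_ : _ / 12 = 1 / 3 * (k.+1%:R / 4)); last by lra.
by rewrite ler_wpM2r // divr_ge0.
Qed.

Lemma L1avg_le (R : realType) (delta : R) (n : nat) :
  0 < delta < 1 -> 32 <= delta * n%:R ->
  L1avg delta n <= (1 - (48 * 1024)^-1 * delta) * n%:R.
Proof.
move=> d01 dn; have /andP[d0 d1] := d01.
have n32 : (32 <= n)%N.
  rewrite -(ler_nat R); apply: le_trans dn _.
  by rewrite -[leRHS]mul1r ler_wpM2r // ltW.
(* The lower bound on [B * delta] makes hits likely; the upper bound keeps [N] of order
   [delta * n]. *)
have [B Bd1 Bd2] : exists2 B : nat, 1 <= B%:R * delta & B%:R * delta <= 2.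
  exists (Num.truncn delta^-1).+1.
    by rewrite -ler_pdivrMr // mul1r ltW // truncnS_gt.
  rewrite -natr1 mulrDl mul1r.
  have : (Num.truncn delta^-1)%:R <= delta^-1 by rewrite truncn_le // invr_ge0 ltW.
  by rewrite -(ler_pM2r d0) mulVf ?gt_eqF //; lra.
have B0 : (0 < B)%N by case: B Bd1 {Bd2} => //; rewrite mul0r ler10.
have Bn : (B <= n)%N.
  by rewrite -(ler_nat R) -(ler_pM2r d0) (mulrC n%:R); lra.
pose N := (n %/ B)%N; pose k := (N %/ 1024)%N.
have N0 : (0 < N)%N by rewrite divn_gt0.
have NB : (N * B <= n)%N by exact: leq_trunc_div.
have nNB : (n <= 2 * (N * B))%N.
  have := divn_eq n B; have := ltn_pmod n B0; rewrite -/N; nia.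
have kN : (1024 * k <= N)%N by rewrite mulnC leq_trunc_div.
(* The loss is stated with [k.+1], so it stays proportional to [N] even when [N < 1024] and
   [k = 0]. *)
have Nk : (N <= 1024 * k.+1)%N.
  by rewrite mulnC ltnW // ltn_ceil.
have [A ->] := L1avg_attained n d01.
apply: le_trans (value_le A d01 n32 NB nNB Bd1 kN) _.
rewrite mulrBl mul1r lerD2l lerN2 => {A}; clearbody k N.
have : n%:R <= 2 * (N%:R * B%:R) :> R by rewrite -!natrM ler_nat.
have : N%:R <= 1024 * k.+1%:R :> R by rewrite -natrM ler_nat.
have : 0 <= N%:R :> R by [].
move: (N%:R : R) (k.+1%:R : R) (n%:R : R) (B%:R : R) Bd1 Bd2 => {dn} x y z w h1 h2 h3 h4 h5.
(* Since [n <= 2 * N * B] and [B * delta <= 2]. Then [delta * n <= 4 * 1024 * k.+1], and dividing by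
   12 gives the constant [48 * 1024]. *)
have h6 : delta * z <= 4 * x.
  have : delta * z <= 2 * x * (w * delta).
    by rewrite (_ : 2 * x * (w * delta) = delta * (2 * (x * w))); [rewrite ler_wpM2l // ltW|ring].
  nra.
lra.
Qed.

Local Open Scope classical_set_scope.
Local Open Scope ring_scope.

Theorem theorem6p3 (R : realType) :
  exists2 c : R, 0 < c &
    forall delta : nat -> R,
      (forall n, 0 < delta n < 1) ->
      delta n * n%:R @[n --> \oo] --> +oo ->
      \forall n \near \oo, L1avg (delta n) n <= (1 - c * delta n) * n%:R.
Proof.
exists (48 * 1024)^-1; first by rewrite invr_gt0; apply: mulr_gt0; rewrite ltr0n.
(* Divergence is used only to have [delta n * n >= 32] eventually. *)
move=> delta d01 /cvgryPge /(_ 32) large.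
by near=> n; apply: L1avg_le; [exact: d01|near: n].
Unshelve. all: by end_near.
Qed.
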